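(* Let $\Delta t>0$, $n\ge 0$, and let $u_h^n\in V_h$, $q_h^n\in V_h$ with $(q_h^n,\psi)=A(u_h^n,\psi)$ for all $\psi\in V_h$, and $r^n\in\mathbb{R}$ be given. Consider one step of the first order SAV-DG scheme: find $(u_h^{n+1},q_h^{n+1},r^{n+1})\in V_h\times V_h\times\mathbb{R}$ such that for all $\phi,\psi\in V_h$, $$(D_tu_h^n,\phi)=-A(q_h^{n+1},\phi)-r^{n+1}(b(u_h^n),\phi),\qquad (q_h^{n+1},\psi)=A(u_h^{n+1},\psi),\qquad D_tr^n=\frac12\int_\Omega b(u_h^n)\,D_tu_h^n\,dx .$$ This step can be realized in two steps, i.e. its solution is exactly the triple obtained as follows. (i) Determine $r^{n+1}$ by $$r^{n+1}=r^n-\frac12(\Pi b(u_h^n),u_h^n)+\frac12R^n,$$ where $$R^n=\frac{\left(b(u_h^n),\mathcal{B}_h(\Delta t)\xi^n\right)}{1+\frac{\Delta t}{2}\left(\Pi b(u_h^n),\mathcal{B}_h(\Delta t)\Pi b(u_h^n)\right)},\qquad \xi^n=u_h^n-\Delta t\,r^n\,\Pi b(u_h^n)+\frac{\Delta t}{2}\left(b(u_h^n),u_h^n\right)\Pi b(u_h^n).$$ (ii) With this $r^{n+1}$, solve the linear system for $(u_h^{n+1},q_h^{n+1})\in V_h\times V_h$: for all $\phi,\psi\in V_h$, $$(D_tu_h^n,\phi)=-A(q_h^{n+1},\phi)-(b(u_h^n),\phi)\,r^{n+1},\qquad (q_h^{n+1},\psi)=A(u_h^{n+1},\psi).$$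
   Context: $\Omega\subset\mathbb{R}^d$ is a convex bounded domain, partitioned by a shape regular mesh $\mathcal{T}_h=\{K\}$; $k$ is a fixed polynomial degree and $V_h=\{v\in L^2(\Omega): v|_K\in P^k(K)\ \forall K\in\mathcal{T}_h\}$, where $P^k(K)$ is the set of polynomials of degree at most $k$ on $K$. $(\cdot,\cdot)$ and $\|\cdot\|$ are the $L^2(\Omega)$ inner product and norm. $\Gamma^0$ is the set of interior interfaces and $\Gamma^\partial$ the set of boundary faces. On an interface $e\subset\partial K_1\cap\partial K_2$ with unit normal $\nu$ oriented from $K_1$ to $K_2$, $\{v\}=\frac12(v|_{\partial K_1}+v|_{\partial K_2})$ and $[v]=v|_{\partial K_2}-v|_{\partial K_1}$, where $v|_{\partial K_i}$ is the trace on $e$ taken from $K_i$. With a real parameter $a$, the bilinear form on $V_h\times V_h$ is $A(w,v)=A^0(w,v)+A^b(w,v)$, $$A^0(w,v)=\sum_{K\in\mathcal{T}_h}\int_K\left(\nabla w\cdot\nabla v-\frac a2wv\right)dx+\sum_{e\in\Gamma^0}\int_e\left(\{\partial_\nu w\}[v]+[w]\{\partial_\nu v\}\right)ds .$$ One of two boundary conditions is fixed: (periodic case) $A^b(w,v)=\frac12\int_{\Gamma^\partial}(\{\partial_\nu w\}[v]+[w]\{\partial_\nu v\})\,ds$, where opposite boundary faces are identified so that each such face has two neighbouring elements (the factor $\frac12$ avoids double counting); or (case $\partial_{\mathbf n}u=\partial_{\mathbf n}\Delta u=0$ on $\partial\Omega$) $A^b(w,v)=0$. $\Phi:\mathbb{R}\to\mathbb{R}$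 is a (nonlinear) continuously differentiable function, and $B$ is a constant such that $\int_\Omega\Phi(v(x))\,dx+B>0$ for all $v\in V_h$. For such $w$, $$b(w)=\frac{\Phi'(w)}{\sqrt{\int_\Omega\Phi(w(x))\,dx+B}} .$$ $\Pi$ is the $L^2$ projection onto $V_h$: $(\Pi w,\phi)=(w,\phi)$ for all $\phi\in V_h$. $D_tv^n=\frac{v^{n+1}-v^n}{\Delta t}$. The operator $\mathcal{L}_h:V_h\to V_h$ is defined by $(\mathcal{L}_hv,\psi)=A(v,\psi)$ for all $\psi\in V_h$. For $\tau>0$, $\mathcal{B}_h(\tau):V_h\to V_h$ is the operator $\mathcal{B}_h(\tau)=(I+\tau\mathcal{L}_h^2)^{-1}$; equivalently $v_h=\mathcal{B}_h(\tau)f_h$ is the first component of the unique solution $(v_h,w_h)\in V_h\times V_h$ of $\tau A(w_h,\phi)+(v_h,\phi)=(f_h,\phi)$, $(w_h,\psi)=A(v_h,\psi)$ for all $\phi,\psi\in V_h$. *)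

(* Defs.v *)
From HB Require Import structures.
From mathcomp Require Import all_boot all_order all_algebra.
From mathcomp Require Import all_classical all_reals all_analysis.
From mathcomp Require mpoly.
Import Order.TTheory GRing.Theory Num.Theory.
Import numFieldNormedType.Exports.

Set Implicit Arguments.
Unset Strict Implicit.
Unset Printing Implicit Defensive.

Local Open Scope classical_set_scope.
Local Open Scope ring_scope.

Section LebesgueTuple.
Context (R : realType).
Local Open Scope ereal_scope.
Local Notation T n := (n.-tuple (measurableTypeR R)).

Definition tcons n (p : measurableTypeR R * T n) : T n.+1 :=
  [tuple of p.1 :: p.2].
Definition tuncons n (t : T n.+1) : measurableTypeR R * T n :=
  (thead t, [tuple of behead t]).

Lemma measurable_tcons n : measurable_fun [set: measurableTypeR R * T n] (@tcons n).
Proof. exact: measurable_cons. Qed.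

Lemma measurable_tuncons n : measurable_fun [set: T n.+1] (@tuncons n).
Proof.
apply/measurable_fun_pairP; split; first exact: (measurable_tnth ord0).
exact: measurable_behead.
Qed.

Lemma tconsK n : cancel (@tcons n) (@tuncons n).
Proof. by move=> [x t]; congr pair; apply: val_inj. Qed.

Section Cons.
Variables (n : nat) (mu : {sigma_finite_measure set (T n) -> \bar R}).

Definition lebesgue_cons : set (T n.+1) -> \bar R :=
  pushforward (@lebesgue_measure R \x mu) (@tcons n).

Let m0 : lebesgue_cons set0 = 0.
Proof. by rewrite /lebesgue_cons /pushforward preimage_set0 measure0. Qed.

Let mge0 A : 0 <= lebesgue_cons A.
Proof. by rewrite /lebesgue_cons /pushforward measure_ge0. Qed.

Let msa : semi_sigma_additive lebesgue_cons.
Proof.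
apply: measure_semi_sigma_additive. exact: measurable_tcons.
Qed.

HB.instance Definition _ := isMeasure.Build _ _ _ lebesgue_cons m0 mge0 msa.

Let msf : sigma_finite setT lebesgue_cons.
Proof.
have /sigma_finiteP[F [FT ndF Foo]] := sigma_finiteT (@lebesgue_measure R).
have /sigma_finiteP[G [GT ndG Goo]] := sigma_finiteT mu.
exists (fun i => @tuncons n @^-1` (F i `*` G i)).
  apply/seteqP; split=> // t _.
  have [i _ Fi] : (\bigcup_i F i) (tuncons t).1 by rewrite -FT.
  have [j _ Gj] : (\bigcup_i G i) (tuncons t).2 by rewrite -GT.
  exists (maxn i j) => //; split.
  - by move: Fi; exact/subsetPset/ndF/leq_maxl.
  - by move: Gj; exact/subsetPset/ndG/leq_maxr.
move=> i; have [mF Fi] := Foo i; have [mG Gi] := Goo i; split.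
  rewrite -[X in measurable X]setTI.
  by apply: measurable_tuncons => //; exact: measurableX.
rewrite /lebesgue_cons /pushforward -comp_preimage.
rewrite (_ : @tuncons n \o @tcons n = id); last exact/funext/tconsK.
by rewrite preimage_id product_measure1E// lte_mul_pinfty// ge0_fin_numE.
Qed.

HB.instance Definition _ := Measure_isSigmaFinite.Build _ _ _ lebesgue_cons msf.

End Cons.

(* Lebesgue measure on n-tuples, as the n-fold product of the measure on R *)
Fixpoint lebesgue_tuple n : {sigma_finite_measure set (T n) -> \bar R} :=
  if n is m.+1 then lebesgue_cons (lebesgue_tuple m) else \d_([tuple]).
End LebesgueTuple.

Section Integral.
Context (R : realType) (n : nat).

Definition rV_of_tuple (t : n.-tuple R) : 'rV[R]_n := \row_i tnth t i.

(* the measurable structure and the measure live on n-tuples, the topology,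
   the norm and the derivatives on row vectors *)
Definition integral_rV (D : set 'rV[R]_n) (f : 'rV[R]_n -> R) : R :=
  \int[lebesgue_tuple R n]_(t in rV_of_tuple @^-1` D) f (rV_of_tuple t).

Definition L2dot (D : set 'rV[R]_n) (f g : 'rV[R]_n -> R) : R :=
  integral_rV D (fun x => f x * g x).

Definition vdot (x y : 'rV[R]_n) : R := \sum_j x 0 j * y 0 j.
Definition enorm (x : 'rV[R]_n) : R := Num.sqrt (vdot x x).

Definition convex_bounded_domain (D : set 'rV[R]_n) : Prop :=
  [/\ open D, D !=set0, convex_set D & bounded_set D].

Definition grad_dot (w v : 'rV[R]_n -> R) (x : 'rV[R]_n) : R :=
  \sum_(j < n) 'D_(delta_mx 0 j) w x * 'D_(delta_mx 0 j) v x.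

Definition trace (K : set 'rV[R]_n) (g : 'rV[R]_n -> R) (x : 'rV[R]_n) : R :=
  lim (g y @[y --> within K (nbhs x)]).

End Integral.

(* The ambient space is R^(d+1), so that its dimension is positive and the faces
   have dimension d. *)
Section Mesh.
Context (R : realType) (d : nat).
Local Notation E := 'rV[R]_d.+1.

(* A flat face is the isometric image of a part of R^d under y |-> x0 + y Q,
   where the rows of Q are orthonormal. It separates the elements number
   fel1 and fel2; fshift is 0 for an interior interface, while for a boundary
   face of a periodic domain fshift carries the face to the opposite one, where
   the element fel2 lies. *)
Record face (m : nat) := Face {
  fparam : set 'rV[R]_d ;
  forig : E ;
  fframe : 'M[R]_(d, d.+1) ;
  fnormal : E ;
  fel1 : 'I_m ;
  fel2 : 'I_m ;
  fshift : E }.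

Definition fpoint m (F : face m) (y : 'rV[R]_d) : E :=
  forig F + y *m fframe F.

Definition fset m (F : face m) : set E := fpoint F @` fparam F.

(* integral with respect to the surface measure ds *)
Definition face_integral m (F : face m) (g : E -> R) : R :=
  integral_rV (fparam F) (fun y => g (fpoint F y)).

(* The last clause says that (up to the shift) the face lies in the boundary of
   both elements and that the normal points from the first to the second. *)
Definition is_face m (K : 'I_m -> set E) (F : face m) : Prop :=
  [/\ [/\ open (fparam F), fparam F !=set0 & convex_set (fparam F)],
      [/\ fframe F *m (fframe F)^T = 1%:M,
          fframe F *m (fnormal F)^T = 0 & enorm (fnormal F) = 1]
    & forall x, fset F x -> \forall t \near 0^'+,
        K (fel1 F) (x - t *: fnormal F) /\
        K (fel2 F) (x + fshift F + t *: fnormal F)].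

Record mesh := Mesh {
  nelem : nat ;
  elem : 'I_nelem -> set E ;
  niface : nat ;
  iface : 'I_niface -> face nelem }.
Arguments elem : clear implicits.
Arguments iface : clear implicits.

Definition is_mesh (Omega : set E) (M : mesh) : Prop :=
  [/\ forall i, [/\ open (elem M i), elem M i !=set0, connected (elem M i)
                  & elem M i `<=` Omega],
      trivIset setT (elem M),
      closure Omega = \bigcup_i closure (elem M i),
      [/\ forall e, [/\ is_face (elem M) (iface M e), fshift (iface M e) = 0,
                        fel1 (iface M e) != fel2 (iface M e)
                      & fset (iface M e) `<=` Omega]
        & trivIset setT (fun e => fset (iface M e))]
    & forall i, Omega `&` (closure (elem M i) `\` elem M i) `<=`
        \bigcup_e closure (fset (iface M e))].

(* diameter over inradius at most sigma *)
Definition shape_regular (sigma : R) (M : mesh) : Prop :=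
  forall i, exists c rho, [/\ 0 < rho,
    (forall x, enorm (x - c) < rho -> elem M i x)
  & (forall x y, elem M i x -> elem M i y -> enorm (x - y) <= sigma * rho)].

(* Periodicity with respect to the lattice spanned by the rows of period; the
   faces listed are all the boundary faces, each one with its outward normal,
   and bopp maps each of them to the opposite one. *)
Record periodicity (m : nat) := Periodicity {
  period : 'M[R]_d.+1 ;
  nbface : nat ;
  bface : 'I_nbface -> face m ;
  bopp : 'I_nbface -> 'I_nbface }.
Arguments bface {m}.
Arguments bopp {m}.

Definition lattice_vec (L : 'M[R]_d.+1) (z : 'rV[int]_d.+1) : E :=
  map_mx intr z *m L.

Definition is_periodicity (Omega : set E) (M : mesh)
    (P : periodicity (nelem M)) : Prop :=
  [/\ [/\ period P \in unitmx,
          forall z x, z != 0 -> Omega x -> ~ Omega (x + lattice_vec (period P) z)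
        & forall x, exists z, closure Omega (x + lattice_vec (period P) z)],
      forall e, [/\ is_face (elem M) (bface P e),
                    exists z, fshift (bface P e) = lattice_vec (period P) z
                  & fset (bface P e) `<=` closure Omega `\` Omega],
      trivIset setT (fun e => fset (bface P e)),
      closure Omega `\` Omega `<=` \bigcup_e closure (fset (bface P e))
    & forall e, let F := bface P e in let F' := bface P (bopp P e) in
        [/\ fset F' = [set x + fshift F | x in fset F],
            fnormal F' = - fnormal F, fshift F' = - fshift F,
            fel1 F' = fel2 F & fel2 F' = fel1 F]].

(* Neumann: vanishing normal derivatives of u and of its Laplacian *)
Inductive boundary_condition (m : nat) :=
  | Periodic of periodicity m
  | Neumann.

Definition is_boundary_condition (Omega : set E) (M : mesh)
    (bc : boundary_condition (nelem M)) : Prop :=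
  match bc with
  | Periodic P => is_periodicity Omega P
  | Neumann => True
  end.

End Mesh.
Arguments elem {R d}.
Arguments iface {R d}.
Arguments bface {R d m}.
Arguments bopp {R d m}.

(* the notations of mpoly clash with those of MathComp-Analysis, and its name
   isMeasure shadows the interface of measures used above *)
Import -(notations) mpoly.

Section DG.
Context (R : realType) (d : nat) (M : mesh R d).
Local Notation E := 'rV[R]_d.+1.

(* A class in L2 that is polynomial of degree at most k on every element is
   represented by its member that vanishes off the (open) elements, so that
   equality of representatives is equality in L2. mmeasure mdeg p is the
   number written msize p in multinomials, i.e. the degree plus one. *)
Definition dg_space (k : nat) : set (E -> R) :=
  [set v | (forall i, exists2 p : mpoly d.+1 R,
              (mmeasure mdeg p <= k.+1)%N
            & forall x, elem M i x -> v x = meval (fun j => x 0 j) p)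
        /\ (forall x, (forall i, ~ elem M i x) -> v x = 0)].

Section Face.
Variable F : face R d (nelem M).

Definition trace1 (g : E -> R) (x : E) : R := trace (elem M (fel1 F)) g x.
Definition trace2 (g : E -> R) (x : E) : R :=
  trace (elem M (fel2 F)) g (x + fshift F).
Definition avg (g : E -> R) (x : E) : R := (trace1 g x + trace2 g x) / 2.
Definition jump (g : E -> R) (x : E) : R := trace2 g x - trace1 g x.
Definition dnormal (g : E -> R) (x : E) : R := 'D_(fnormal F) g x.

Definition face_form (w v : E -> R) : R :=
  face_integral F (fun x => avg (dnormal w) x * jump v x
                          + jump w x * avg (dnormal v) x).

End Face.

Definition dg_form0 (a : R) (w v : E -> R) : R :=
  \sum_(i < nelem M)
     integral_rV (elem M i) (fun x => grad_dot w v x - a / 2 * w x * v x)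
  + \sum_(e < niface M) face_form (iface M e) w v.

Definition dg_formb (bc : boundary_condition R d (nelem M)) (w v : E -> R) : R :=
  match bc with
  | Periodic P => 2^-1 * \sum_(e < nbface P) face_form (bface P e) w v
  | Neumann => 0
  end.

Definition dg_form bc (a : R) (w v : E -> R) : R :=
  dg_form0 a w v + dg_formb bc w v.

End DG.

Section Operators.
Context (R : realType) (n : nat).
Local Notation fct := ('rV[R]_n -> R).
Variables (Omega : set 'rV[R]_n) (V : set fct).

Definition L2proj (f : fct) : fct :=
  xget (cst 0) [set w | V w /\ forall phi, V phi ->
                          L2dot Omega w phi = L2dot Omega f phi].

Definition form_op (A : fct -> fct -> R) (v : fct) : fct :=
  xget (cst 0) [set z | V z /\ forall psi, V psi -> L2dot Omega z psi = A v psi].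

(* (I + tau L^2)^-1 on V, where L = form_op A *)
Definition inv_I_sqr (A : fct -> fct -> R) (tau : R) (f : fct) : fct :=
  xget (cst 0)
    [set v | V v /\ (fun x => v x + tau * form_op A (form_op A v) x) = f].

Definition sav_b (Phi : R -> R) (B : R) (w : fct) : fct :=
  fun x => derive1 Phi (w x) / Num.sqrt (integral_rV Omega (fun y => Phi (w y)) + B).

End Operators.

(* Main.v *)
(* Only four facts matter: V_h is finite-dimensional, the L2 product is definite
   on it, A is bilinear, and A is symmetric. Then (v, w) + tau (L v, L w) is an
   inner product on V_h, and B(tau) f is the Riesz representative of (f, .) for
   it. Hence the first two equations of the scheme say that
   u^(n+1) = B(dt) (u^n - dt r^(n+1) Pi b) and q^(n+1) = L u^(n+1). With
   s = (b, u^(n+1)), the third one says that r^(n+1) = r^n + (s - (b, u^n)) / 2,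
   so that u^(n+1) = B xi - (dt / 2) s B (Pi b); testing against b gives
   s den = (b, B xi), i.e. s = R^n, where den >= 1 because B is positive. The
   converse reads the same computation backwards.
   A is well defined and bilinear because on the elements the functions of V_h
   and their derivatives extend to continuous functions, which gives the traces
   and the integrability of all the integrands. *)

Require Import Defs.
From mathcomp Require Import measurable_realfun.
From mathcomp Require Import ring lra.
From HB Require Import structures.
From mathcomp Require Import all_boot all_order all_algebra.
From mathcomp Require Import all_classical all_reals all_analysis.
Import Order.TTheory GRing.Theory Num.Theory.
Import numFieldNormedType.Exports.

Set Implicit Arguments.
Unset Strict Implicit.
Unset Printing Implicit Defensive.

Local Open Scope classical_set_scope.
Local Open Scope ring_scope.

(** * Riesz representation on a finite-dimensional function space *)

Section Riesz.
Context (R : realType) (T : Type).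
Local Notation fct := (T -> R).

(** Together with [V (cst 0)], this one condition makes [V] a linear subspace; [linear_on] uses the
    same combination, so scaling and addition are treated at once. *)
Definition lin_closed (V : set fct) : Prop :=
  forall c f g, V f -> V g -> V (fun x => c * f x + g x).

(** A spanning family suffices: the argument in [riesz] tolerates a singular Gram matrix, so no
    basis has to be extracted. *)
Definition finite_dim (V : set fct) : Prop :=
  exists (N : nat) (e : 'I_N -> fct), (forall i, V (e i)) /\
    forall v, V v -> exists c : 'I_N -> R, v = (fun x => \sum_i c i * e i x).

Definition linear_on (V : set fct) (l : fct -> R) : Prop :=
  forall c f g, V f -> V g -> l (fun x => c * f x + g x) = c * l f + l g.

Definition bilinear_on (V : set fct) (D : fct -> fct -> R) : Prop :=
  (forall g, V g -> linear_on V (D ^~ g)) /\ (forall f, V f -> linear_on V (D f)).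

Section LinearOn.
Variables (V : set fct) (V0 : V (cst 0)) (Vlin : lin_closed V).

Lemma lin_closed_sum N (c : 'I_N -> R) (e : 'I_N -> fct) :
  (forall i, V (e i)) -> V (fun x => \sum_i c i * e i x).
Proof.
move=> Ve; elim: (index_enum _) => [|i r IH].
  by rewrite (_ : (fun _ => _) = cst 0)//; apply/funext => x; rewrite big_nil.
rewrite (_ : (fun _ => _) = fun x => c i * e i x + \sum_(j <- r) c j * e j x).
  exact: Vlin.
by apply/funext => x; rewrite big_cons.
Qed.

Lemma lin_closedB f g : V f -> V g -> V (fun x => f x - g x).
Proof.
move=> Vf Vg; rewrite (_ : (fun x => _) = fun x => -1 * g x + f x).
  exact: Vlin.
by apply/funext => x; rewrite mulN1r addrC.
Qed.

Variables (l : fct -> R) (llin : linear_on V l).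

Lemma linear_on0 : l (cst 0) = 0.
Proof.
have := llin 1 V0 V0; rewrite mul1r (_ : (fun _ => _) = cst 0).
  by move/eqP; rewrite -[X in X == _]addr0 (inj_eq (addrI _)) => /eqP.
by apply/funext => x; rewrite mul1r addr0.
Qed.

Lemma linear_onB f g : V f -> V g -> l (fun x => f x - g x) = l f - l g.
Proof.
move=> Vf Vg; rewrite (_ : (fun x => _) = fun x => -1 * g x + f x).
  by rewrite llin// mulN1r addrC.
by apply/funext => x; rewrite mulN1r addrC.
Qed.

Lemma linear_on_sum N (c : 'I_N -> R) (e : 'I_N -> fct) :
  (forall i, V (e i)) ->
  l (fun x => \sum_i c i * e i x) = \sum_i c i * l (e i).
Proof.
(* The induction carries membership in [V] along with the value, since [llin] applies only to
   partial sums known to lie in [V]. *)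
move=> Ve; pose P (h : fct) y := V h /\ l h = y.
suff: P (fun x => \sum_i c i * e i x) (\sum_i c i * l (e i)) by case.
elim: (index_enum _) => [|i r [Vr IH]].
  rewrite (_ : (fun _ => _) = cst 0) ?big_nil.
    by split=> //; exact: linear_on0.
  by apply/funext => x; rewrite big_nil.
rewrite (_ : (fun _ => _) = fun x => c i * e i x + \sum_(j <- r) c j * e j x).
  by split; [exact: Vlin|rewrite llin// IH big_cons].
by apply/funext => x; rewrite big_cons.
Qed.

End LinearOn.

(* The Gram matrix of a spanning family may be singular, but its kernel consists
   of the coefficients of 0, on which every linear functional vanishes. *)
Lemma riesz (V : set fct) (D : fct -> fct -> R) (l : fct -> R) :
  V (cst 0) -> lin_closed V -> finite_dim V -> bilinear_on V D ->
  (forall v, V v -> D v v = 0 -> v = cst 0) -> linear_on V l ->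
  exists2 z, V z & forall phi, V phi -> D z phi = l phi.
Proof.
move=> V0 Vlin [N [e [Ve Vspan]]] [Dl Dr] Ddef llin.
pose G := \matrix_(i < N, j < N) D (e i) (e j).
pose L := \row_(j < N) l (e j).
have /submxP[c Lc] : (L <= G)%MS.
  rewrite submxE; apply/eqP/rowP => j; rewrite !mxE.
  (* A column of the cokernel matrix is killed by [G], so the combination [v] it defines is
     orthogonal for [D] to every [e i], hence to itself. *)
  pose k i : R := cokermx G i j.
  pose v x := \sum_i k i * e i x.
  have Vv : V v by exact: lin_closed_sum.
  have Dv i : D (e i) v = 0.
    rewrite (linear_on_sum V0 Vlin (Dr _ (Ve i)))//.
    have /matrixP/(_ i j) := mulmx_coker G; rewrite !mxE => Gk.
    rewrite -[RHS]Gk.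
    by apply: eq_bigr => h _; rewrite mxE mulrC.
  have v0 : v = cst 0.
    apply: Ddef => //.
    rewrite {1}/v (linear_on_sum V0 Vlin (Dl _ Vv))//.
    by rewrite big1// => i _; rewrite Dv mulr0.
  rewrite -[RHS](linear_on0 V0 llin) -v0 (linear_on_sum V0 Vlin llin)//.
  by apply: eq_bigr => i _; rewrite mxE mulrC.
exists (fun x => \sum_i c 0 i * e i x); first exact: lin_closed_sum.
move=> phi Vphi; have [a ->] := Vspan _ Vphi.
rewrite (linear_on_sum V0 Vlin llin)//.
have Vz : V (fun x => \sum_i c 0 i * e i x) by exact: lin_closed_sum.
rewrite (linear_on_sum V0 Vlin (Dr _ Vz))//.
apply: eq_bigr => j _; congr (_ * _).
rewrite (linear_on_sum V0 Vlin (Dl _ (Ve j)))//.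
have /rowP/(_ j) := Lc; rewrite !mxE => ->.
by apply: eq_bigr => i _; rewrite mxE.
Qed.

Lemma sym_bilinear_on (V : set fct) (D : fct -> fct -> R) :
  (forall f g, D f g = D g f) -> (forall g, V g -> linear_on V (D ^~ g)) ->
  bilinear_on V D.
Proof. by move=> DC lin; split=> // f Vf c g h Vg Vh; rewrite !(DC f) lin. Qed.

(** Uniqueness to match the existence in [riesz]: the test function is the difference of [v] and
    [w]. *)
Lemma bilinear_on_inj (V : set fct) (D : fct -> fct -> R) v w :
  lin_closed V -> bilinear_on V D ->
  (forall v, V v -> D v v = 0 -> v = cst 0) -> V v -> V w ->
  (forall phi, V phi -> D v phi = D w phi) -> v = w.
Proof.
move=> Vlin [Dl _] Ddef Vv Vw vw.
have Vd : V (fun x => v x - w x) by exact: lin_closedB.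
have d0 : (fun x => v x - w x) = cst 0.
  by apply: Ddef => //; rewrite (linear_onB (Dl _ Vd))// vw// subrr.
apply/funext => x; apply/eqP; rewrite -subr_eq0.
by have /(congr1 (@^~ x)) /= -> := d0.
Qed.

End Riesz.

(** * One step of the scheme *)

Section SavStep.
Context (R : realType) (n : nat).
Local Notation fct := ('rV[R]_n -> R).
Variables (Omega : set 'rV[R]_n) (V W : set fct) (A : fct -> fct -> R).
Local Notation dot := (L2dot Omega).
Local Notation L := (form_op Omega V A).
Local Notation Pi := (L2proj Omega V).
Local Notation Bh := (inv_I_sqr Omega V A).

Lemma L2dotC f g : dot f g = dot g f.
Proof.
by congr (integral_rV _ _); apply/funext => x; rewrite mulrC.
Qed.

Lemma L2dot_ge0 f : 0 <= dot f f.
Proof. by apply: Rintegral_ge0 => t _; rewrite -expr2 sqr_ge0. Qed.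

(* W is where the L2 product is bilinear: b(u_h^n) lies in W but not in V. *)
Hypotheses (V0 : V (cst 0)) (Vlin : lin_closed V) (Vfin : finite_dim V).
Hypotheses (VW : V `<=` W) (dot_bilin : bilinear_on W dot).
Hypothesis dot_def : forall v, V v -> dot v v = 0 -> v = cst 0.
Hypotheses (A_bilin : bilinear_on V A) (AC : forall w v, A w v = A v w).

Lemma L2dot_bilin : bilinear_on V dot.
Proof.
by case: dot_bilin => dl dr; split=> h Vh c f g Vf Vg;
  [apply: dl|apply: dr]; exact: VW.
Qed.

(** The choice operator [xget] meets its specification once a witness exists; [riesz] gives one for
    the functional [dot f], which is linear on [V] because [f] lies in [W]. *)
Lemma L2projP f : W f ->
  V (Pi f) /\ forall phi, V phi -> dot (Pi f) phi = dot f phi.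
Proof.
move=> Wf; apply: (@xgetPex _ (cst 0)
  [set w | V w /\ forall phi, V phi -> dot w phi = dot f phi]).
have [|z Vz Dz] := @riesz _ _ V dot (dot f) V0 Vlin Vfin L2dot_bilin dot_def.
  by move=> c g h Vg Vh; apply: (proj2 dot_bilin) => //; exact: VW.
by exists z.
Qed.

Lemma form_opP v : V v ->
  V (L v) /\ forall psi, V psi -> dot (L v) psi = A v psi.
Proof.
move=> Vv; apply: (@xgetPex _ (cst 0)
  [set z | V z /\ forall psi, V psi -> dot z psi = A v psi]).
have [|z Vz Dz] := @riesz _ _ V dot (A v) V0 Vlin Vfin L2dot_bilin dot_def.
  exact: (proj2 A_bilin).
by exists z.
Qed.

(** This turns the second equation of the scheme into [q = L u]. *)
Lemma form_op_eq v q : V v -> V q ->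
  (forall psi, V psi -> dot q psi = A v psi) -> q = L v.
Proof.
move=> Vv Vq qA; have [VL LA] := form_opP Vv.
by apply: (bilinear_on_inj Vlin L2dot_bilin) => // psi Vpsi; rewrite qA// LA.
Qed.

(** The weak form of [I + tau L^2] (see [energy_formE]), with one factor [L] moved to the second
    argument so that symmetry and coercivity are visible. *)
Definition energy_form (tau : R) (v w : fct) : R :=
  dot v w + tau * dot (L v) (L w).

Section InvISqr.
Variables (tau : R) (tau_gt0 : 0 < tau).
Local Notation D := (energy_form tau).

Lemma energy_formC v w : D v w = D w v.
Proof. by rewrite /energy_form L2dotC (L2dotC (L v)). Qed.

Lemma energy_form_bilin : bilinear_on V D.
Proof.
apply: sym_bilinear_on => [|g Vg]; first exact: energy_formC.
move=> c f h Vf Vh; rewrite /energy_form.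
have [VLg _] := form_opP Vg.
(* Linearity of [L] is bypassed: [dot (L v) (L g)] equals [A v (L g)], and [A] is linear in its
   first argument. *)
rewrite (proj1 L2dot_bilin _ Vg)//.
rewrite (proj2 (form_opP (Vlin c Vf Vh)))// (proj2 (form_opP Vf))//.
rewrite (proj2 (form_opP Vh))// (proj1 A_bilin _ VLg)//.
by rewrite !mulrDr mulrCA addrACA.
Qed.

(** Coercivity, the source both of definiteness and of the positivity of [den]. *)
Lemma energy_form_ge v : dot v v <= D v v.
Proof. by rewrite lerDl mulr_ge0 ?L2dot_ge0// ltW. Qed.

Lemma energy_form_def v : V v -> D v v = 0 -> v = cst 0.
Proof.
move=> Vv Dv; apply: dot_def => //; apply/eqP.
by rewrite eq_le L2dot_ge0 andbT -Dv energy_form_ge.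
Qed.

(** Symmetry of [A] makes [L] self-adjoint: [dot (L (L v)) phi = A (L v) phi = A phi (L v) = dot (L
    phi) (L v)]. *)
Lemma energy_formE v phi : V v -> V phi ->
  D v phi = dot (fun x => v x + tau * L (L v) x) phi.
Proof.
move=> Vv Vphi; have [VLv _] := form_opP Vv.
have [VLLv LLv] := form_opP VLv.
rewrite (_ : (fun x => _) = (fun x => tau * L (L v) x + v x)); last first.
  by apply/funext => x; rewrite addrC.
rewrite (proj1 L2dot_bilin _ Vphi)// LLv// AC -(proj2 (form_opP Vphi))//.
by rewrite /energy_form addrC (L2dotC (L v)).
Qed.

(** [riesz] solves the weak equation; it becomes the equality of functions required by [inv_I_sqr]
    because both sides lie in [V] and agree against all of [V]. *)
Lemma inv_I_sqrP f : V f ->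
  V (Bh tau f) /\ forall phi, V phi -> D (Bh tau f) phi = dot f phi.
Proof.
move=> Vf.
have [|Vv Bv] := @xgetPex _ (cst 0)
  [set v | V v /\ (fun x => v x + tau * L (L v) x) = f].
  have [|z Vz Dz] := @riesz _ _ V D (dot f) V0 Vlin Vfin energy_form_bilin
    energy_form_def.
    exact: (proj2 L2dot_bilin).
  exists z; split=> //.
  have [VLz _] := form_opP Vz; have [VLLz _] := form_opP VLz.
  apply: (bilinear_on_inj Vlin L2dot_bilin) => //.
    rewrite (_ : (fun x => _) = (fun x => tau * L (L z) x + z x)); last first.
      by apply/funext => x; rewrite addrC.
    exact: Vlin.
  by move=> phi Vphi; rewrite -energy_formE// Dz.
by split=> // phi Vphi; rewrite energy_formE//; congr (dot _ _).
Qed.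

Lemma inv_I_sqr_eq f v : V f -> V v ->
  (forall phi, V phi -> D v phi = dot f phi) -> v = Bh tau f.
Proof.
move=> Vf Vv Dv; have [VB BD] := inv_I_sqrP Vf.
apply: (bilinear_on_inj Vlin energy_form_bilin energy_form_def) => // phi Vphi.
by rewrite Dv// BD.
Qed.

Lemma inv_I_sqr_lin c f g : V f -> V g ->
  Bh tau (fun x => c * f x + g x) = fun x => c * Bh tau f x + Bh tau g x.
Proof.
move=> Vf Vg; have [VBf Bf] := inv_I_sqrP Vf; have [VBg Bg] := inv_I_sqrP Vg.
apply/esym/inv_I_sqr_eq; [exact: Vlin|exact: Vlin|move=> phi Vphi].
rewrite (proj1 energy_form_bilin _ Vphi)// Bf// Bg//.
by rewrite (proj1 L2dot_bilin _ Vphi).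
Qed.

End InvISqr.

(** * Elimination of the scalar unknown from the scheme *)

Variables (dt rn : R) (un b : fct).
Hypotheses (dt_gt0 : 0 < dt) (Vun : V un) (Wb : W b).

Let Dt (u : fct) := fun x => (u x - un x) / dt.
Let lin_step u q r :=
  [/\ V u, V q,
      forall phi, V phi -> dot (Dt u) phi = - A q phi - dot b phi * r
    & forall psi, V psi -> dot q psi = A u psi].
Let sav_step u q r :=
  [/\ V u, V q,
      forall phi, V phi -> dot (Dt u) phi = - A q phi - r * dot b phi,
      forall psi, V psi -> dot q psi = A u psi
    & (r - rn) / dt = 2^-1 * integral_rV Omega (fun x => b x * Dt u x)].
Let xi := fun x => un x - dt * rn * Pi b x + dt / 2 * dot b un * Pi b x.
Let den := 1 + dt / 2 * dot (Pi b) (Bh dt (Pi b)).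
Let Rn := dot b (Bh dt xi) / den.
Let r1 := rn - 2^-1 * dot (Pi b) un + 2^-1 * Rn.

Let dt_neq0 : dt != 0. Proof. by rewrite gt_eqF. Qed.

Lemma L2dot_Dt u g : V u -> W g -> dot (Dt u) g = (dot u g - dot un g) / dt.
Proof.
move=> Vu Wg; have Vd := lin_closedB Vlin Vu Vun.
(* The zero summand gives the quotient the shape [c * f + g] to which linearity applies. *)
rewrite (_ : Dt u = fun x => dt^-1 * (u x - un x) + cst 0 x); last first.
  by apply/funext => x; rewrite addr0 mulrC.
have dl := proj1 dot_bilin _ Wg.
rewrite dl; [|exact: VW..].
rewrite (linear_on0 (VW V0) dl) addr0 (linear_onB dl); [|exact: VW..].
by rewrite mulrC.
Qed.

Lemma lin_stepE u q r : lin_step u q r <->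
  [/\ V u, u = Bh dt (fun x => (- (dt * r)) * Pi b x + un x) & q = L u].
Proof.
have [VP Pb] := L2projP Wb.
have Vf : V (fun x => (- (dt * r)) * Pi b x + un x) by exact: Vlin.
(* After multiplication by [dt], and since [A (L v) phi = dot (L v) (L phi)], the evolution equation
   is the weak equation that characterizes [Bh dt]. *)
have key v phi : V v -> V phi ->
  (dot (Dt v) phi = - A (L v) phi - dot b phi * r <->
   energy_form dt v phi = dot (fun x => (- (dt * r)) * Pi b x + un x) phi).
  move=> Vv Vphi; have [VLv Lv] := form_opP Vv.
  rewrite L2dot_Dt//; last exact: VW.
  rewrite (proj1 L2dot_bilin _ Vphi)// Pb// /energy_form.
  rewrite AC -(proj2 (form_opP Vphi))// (L2dotC (L phi)).
  set x := dot v _; set y := dot un _; set z := dot (L v) _; set t := dot b _.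
  split=> [E|E].
    have : x - y = (- z - t * r) * dt by rewrite -E divfK.
    by move/eqP; rewrite subr_eq => /eqP ->; ring.
  apply: (mulIf dt_neq0); rewrite divfK//.
  by move/eqP: E; rewrite eq_sym -subr_eq => /eqP <-; ring.
split=> [[Vu Vq step qA]|[Vu uE qE]].
  have qL : q = L u by exact: form_op_eq.
  split=> //; apply: inv_I_sqr_eq => // phi Vphi.
  by apply/(key _ _ Vu Vphi); rewrite -qL step.
have [VLu Lu] := form_opP Vu.
split=> //; rewrite qE// => phi Vphi; apply/(key _ _ Vu Vphi).
by rewrite uE; exact: (proj2 (inv_I_sqrP dt_gt0 Vf)).
Qed.

(** The factor [1 / dt] occurs on both sides of the third equation and cancels; what remains is
    still implicit, as [r] depends on [u] through [dot b u]. *)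
Lemma sav_stepE u q r : sav_step u q r <->
  lin_step u q r /\ r = rn + 2^-1 * (dot b u - dot b un).
Proof.
have rE : V u -> ((r - rn) / dt = 2^-1 * integral_rV Omega (fun x => b x * Dt u x))
    <-> r = rn + 2^-1 * (dot b u - dot b un).
  move=> Vu; rewrite -[integral_rV _ _]/(dot b (Dt u)) L2dotC L2dot_Dt//.
  rewrite mulrA (L2dotC u) (L2dotC un); split=> [|->].
    by move/(mulIf (invr_neq0 dt_neq0))/eqP; rewrite subr_eq addrC => /eqP.
  by rewrite addrAC subrr add0r.
split=> [[Vu Vq s qA /(rE Vu) rr]|[[Vu Vq s qA] /(rE Vu) rr]]; split=> //.
  by split=> // phi Vphi; rewrite s// [r * _]mulrC.
by move=> phi Vphi; rewrite s// [r * _]mulrC.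
Qed.

Lemma sav_den_gt0 : 0 < den.
Proof.
have [VP _] := L2projP Wb; have [VB BD] := inv_I_sqrP dt_gt0 VP.
rewrite ltr_pwDl// mulr_ge0//; first by rewrite divr_ge0// ltW.
(* By the weak equation, [dot (Pi b) (Bh dt (Pi b))] is the energy of [Bh dt (Pi b)]. *)
by rewrite -BD//; apply: le_trans (energy_form_ge dt_gt0 _); exact: L2dot_ge0.
Qed.

(* u = B xi - (dt/2) s B (Pi b), tested against b, where s stands for (b, u) *)
Lemma L2dot_b_inv u s r : r = rn + 2^-1 * (s - dot b un) ->
  u = Bh dt (fun x => (- (dt * r)) * Pi b x + un x) ->
  dot b u = dot b (Bh dt xi) - (den - 1) * s.
Proof.
move=> rE uE; have [VP Pb] := L2projP Wb; have [VB BD] := inv_I_sqrP dt_gt0 VP.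
have Vxi : V xi.
  rewrite (_ : xi = fun x => (dt / 2 * dot b un - dt * rn) * Pi b x + un x).
    exact: Vlin.
  by apply/funext => x; rewrite /xi; ring.
have [VBx _] := inv_I_sqrP dt_gt0 Vxi.
(* Once [r] is replaced through [rE], [xi] collects exactly the terms of the argument of [Bh dt]
   that are free of [s]. *)
have -> : u = fun x => (- (dt / 2 * s)) * Bh dt (Pi b) x + Bh dt xi x.
  rewrite uE -inv_I_sqr_lin//; congr Bh; apply/funext => x.
  by rewrite rE /xi; field.
rewrite (proj2 dot_bilin _ Wb); [|exact: VW..].
by rewrite /den Pb//; ring.
Qed.

Lemma sav_step_realization :
  [/\ den != 0,
      exists! s, sav_step s.1.1 s.1.2 s.2
    & forall u q r, sav_step u q r <-> r = r1 /\ lin_step u q r1].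
Proof.
have [VP Pb] := L2projP Wb.
have den0 : den != 0 by rewrite gt_eqF// sav_den_gt0.
have r1E : r1 = rn + 2^-1 * (Rn - dot b un).
  by rewrite /r1 Pb//; ring.
have bE : dot b (Bh dt xi) = Rn * den by rewrite divfK.
have main u q r : sav_step u q r <-> r = r1 /\ lin_step u q r1.
  rewrite sav_stepE; split=> [[ls rE]|[-> ls]].
    have [_ uE _] := (lin_stepE u q r).1 ls.
    have rr : r = r1.
      (* With [s] equal to [dot b u], [L2dot_b_inv] reads [dot b u * den = dot b (Bh dt xi)], so
         [dot b u = Rn]. *)
      rewrite r1E rE; congr (_ + _ * (_ - _)); apply: (mulIf den0).
      rewrite -bE; have /eqP := L2dot_b_inv rE uE.
      by rewrite eq_sym subr_eq => /eqP ->; ring.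
    by split=> //; rewrite -rr.
  (* Conversely [s] is taken to be [Rn]: then [dot b u = Rn * den - (den - 1) * Rn = Rn], which is
     the third equation. *)
  split=> //; have [_ uE _] := (lin_stepE u q r1).1 ls.
  by rewrite (L2dot_b_inv r1E uE) bE r1E; ring.
split=> //.
(* With [r] forced to be [r1], [lin_stepE] gives [u] and [q] explicitly, which settles both
   existence and uniqueness. *)
pose u := Bh dt (fun x => (- (dt * r1)) * Pi b x + un x).
have Vu : V u by apply: (proj1 (inv_I_sqrP dt_gt0 _)); exact: Vlin.
exists (u, L u, r1); split; first by apply/main; split=> //; apply/lin_stepE.
by move=> [[v q] r] /= /main[-> /lin_stepE[_ -> ->]].
Qed.

End SavStep.

(** * Lebesgue measure on row vectors *)

Section TupleMeasure.
Context (R : realType).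
Local Notation T n := (n.-tuple (measurableTypeR R)).
Local Notation rVT n := (fun t : T n => rV_of_tuple t : 'rV[R]_n).
Local Notation mu n := (lebesgue_tuple R n).

(** Row vectors carry the sup norm, so balls are products of intervals, the sets that a product
    measure handles directly. *)
Lemma rV_of_tuple_ball n (c : 'rV[R]_n) (e : R) : 0 < e ->
  rVT n @^-1` ball c e =
  \bigcap_(i in [set: 'I_n]) ((fun t : T n => tnth t i) @^-1` ball (c 0 i) e).
Proof.
move=> e0; apply/seteqP; split=> [t [_ /= ct] i _|t ct].
  by have := ct 0 i; rewrite mxE.
by split=> // i j; rewrite ord1 mxE; exact: (ct j I).
Qed.

Lemma measurable_rV_ball n (c : 'rV[R]_n) (e : R) : 0 < e ->
  measurable (rVT n @^-1` ball c e).
Proof.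
move=> e0; rewrite rV_of_tuple_ball//; apply: fin_bigcap_measurable => // i _.
rewrite -[X in measurable X]setTI; apply: measurable_tnth => //.
exact: measurable_ball.
Qed.

(** A countable base of the topology: rational centres and radii [1 / (m + 1)]. The radius is chosen
    below [e / 2], so that a ball containing [x] stays within distance [e] of it. *)
Lemma ball_rat_rV n (x : 'rV[R]_n) (U : set 'rV[R]_n) : open U -> U x ->
  exists q : 'rV[rat]_n * nat,
    let B := ball (map_mx ratr q.1 : 'rV[R]_n) (q.2.+1%:R^-1) in B x /\ B `<=` U.
Proof.
move=> oU /oU /nbhs_ballP[e /= e0 xeU].
have [m _ /(_ m (leqnn _)) /= me] : \forall m \near \oo, m.+1%:R^-1 < e / 2.
  have e20 : 0 < e / 2 by rewrite divr_gt0.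
  exact: (near_infty_natSinv_lt (PosNum e20)).
have r0 : 0 < m.+1%:R^-1 :> R by rewrite invr_gt0.
have /choice[q qP] (j : 'I_n) :
    exists q : rat, ratr q \in `]x 0 j - m.+1%:R^-1, x 0 j + m.+1%:R^-1[.
  by apply: rat_in_itvoo; rewrite ltrBlDr -addrA ltrDl addr_gt0.
exists (\row_j q j, m) => /=.
set c : 'rV[R]_n := map_mx ratr _.
have xq : ball c m.+1%:R^-1 x.
  split=> // i j; rewrite ord1 !mxE -ball_normE /= distrC ltr_distlC.
  by have := qP j; rewrite in_itv.
split=> // y qy; apply: xeU.
rewrite [e]splitr; apply: (@ball_triangle _ _ c).
  by apply/ball_sym; apply: le_ball xq; exact: ltW.
by apply: le_ball qy; exact: ltW.
Qed.

Lemma measurable_open_rV n (U : set 'rV[R]_n) : open U ->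
  measurable (rVT n @^-1` U).
Proof.
move=> oU.
pose B (q : 'rV[rat]_n * nat) := ball (map_mx ratr q.1 : 'rV[R]_n) (q.2.+1%:R^-1).
(* The union runs over all indices of the base, a countable type; balls not contained in [U] are
   replaced by the empty set. *)
rewrite (_ : _ @^-1` _ = \bigcup_(q : 'rV[rat]_n * nat)
    (if `[< B q `<=` U >] then rVT n @^-1` B q else set0)).
  apply: countable_bigcupT_measurable => // q.
  by case: ifPn => // _; apply: measurable_rV_ball; rewrite invr_gt0.
apply/seteqP; split=> [t /= Ut|t [q _]].
  have [q /= [Bt BU]] := ball_rat_rV oU Ut.
  by exists q => //; rewrite (asboolT BU).
by case: asboolP => // BU; exact: BU.
Qed.

Lemma lebesgue_tuple_ball n (c : 'rV[R]_n) (e : R) : 0 < e ->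
  mu n (rVT n @^-1` ball c e) = ((e *+ 2) ^+ n)%:E.
Proof.
move=> e0; elim: n c => [|n IH] c.
  (* In dimension 0 the measure is the Dirac mass at the empty tuple, which lies in every ball. *)
  by rewrite [LHS]diracE mem_set// rV_of_tuple_ball// => -[].
have -> : mu n.+1 (rVT n.+1 @^-1` ball c e) =
    (@lebesgue_measure R \x mu n)%E (@tcons R n @^-1` (rVT n.+1 @^-1` ball c e)).
  by [].
rewrite (_ : @tcons R n @^-1` _ =
    ball (c 0 0) e `*` (rVT n @^-1` ball (\row_j c 0 (lift 0 j)) e)).
  rewrite product_measure1E; [|exact: measurable_ball|exact: measurable_rV_ball].
  rewrite IH [X in (X * _)%E](lebesgue_measure_ball (c 0 0) (ltW e0)).
  by rewrite -EFinM exprS.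
rewrite !rV_of_tuple_ball//; apply/seteqP; split=> -[a t] /=.
  move=> ct; split; first by have := ct 0 I.
  by move=> i _ /=; have := ct (lift 0 i) I; rewrite /= mxE tnthS.
move=> [ca ct] i _ /=; have [j ->|->] := unliftP 0 i.
  by have := ct j I; rewrite /= mxE tnthS.
exact: ca.
Qed.

Lemma lebesgue_tuple_bounded n (D : set 'rV[R]_n) :
  measurable (rVT n @^-1` D) -> bounded_set D ->
  (mu n (rVT n @^-1` D) < +oo)%E.
Proof.
move=> mD [C [_ DC]].
(* [bounded_set] bounds the norm by any number above [C], such as [|C| + 1]; one more unit gives the
   strict inequality of an open ball. *)
have C1 : 0 < `|C| + 2 by rewrite ltr_wpDl.
have DB : D `<=` ball 0 (`|C| + 2).
  move=> x Dx; rewrite -ball_normE /= sub0r normrN.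
  apply: (@le_lt_trans _ _ (`|C| + 1)); last by rewrite ltrD2l ltr1n.
  by apply: DC => //; rewrite (le_lt_trans (ler_norm _))// ltrDl.
apply: (@le_lt_trans _ _ (mu n (rVT n @^-1` ball 0 (`|C| + 2)))).
  apply: le_measure; rewrite ?inE//; first exact: measurable_rV_ball.
  by move=> t; exact: DB.
by rewrite lebesgue_tuple_ball// ltry.
Qed.

End TupleMeasure.

(** * Bounded measurable functions, continuous extensions and traces *)

Section BoundedMeasurable.
Context (R : realType) (n : nat).
Local Notation T := (n.-tuple (measurableTypeR R)).
Local Notation E := ('rV[R]_n).
Local Notation fct := (E -> R).
Local Notation rVT := (fun t : T => rV_of_tuple t : E).
Implicit Types (D K : set E) (f g : fct).

Definition bounded_meas_set D : Prop :=
  measurable (rVT @^-1` D) /\ bounded_set D.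

Lemma open_bounded_meas_set D : open D -> bounded_set D -> bounded_meas_set D.
Proof. by move=> oD bD; split=> //; exact: measurable_open_rV. Qed.

(** The concrete choice for the space [W] of the abstract step: stable under products, and
    integrable on bounded measurable sets. Measurability is stated after composition because the
    measure lives on tuples. *)
Definition bounded_meas D : set fct :=
  [set f : fct | measurable_fun (rVT @^-1` D) (f \o rVT) /\
           exists C, forall x, D x -> `|f x| <= C].

Lemma bounded_meas_cst D (c : R) : bounded_meas D (cst c).
Proof.
by split; [exact: measurable_cst|exists `|c|].
Qed.

Lemma bounded_measD D f g : bounded_meas D f -> bounded_meas D g ->
  bounded_meas D (fun x => f x + g x).
Proof.
move=> [mf [C fC]] [mg [C' gC]]; split; first exact: measurable_funD.
by exists (C + C') => x Dx; rewrite (le_trans (ler_normD _ _))// lerD// ?fC ?gC.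
Qed.

Lemma bounded_measM D f g : bounded_meas D f -> bounded_meas D g ->
  bounded_meas D (fun x => f x * g x).
Proof.
move=> [mf [C fC]] [mg [C' gC]]; split; first exact: measurable_funM.
by exists (C * C') => x Dx; rewrite normrM ler_pM ?fC ?gC.
Qed.

Lemma bounded_meas_lin D : lin_closed (bounded_meas D).
Proof.
move=> c f g Df Dg; apply: bounded_measD => //; apply: bounded_measM => //.
exact: bounded_meas_cst.
Qed.

Lemma bounded_meas_integrable D f : bounded_meas_set D -> bounded_meas D f ->
  (lebesgue_tuple R n).-integrable (rVT @^-1` D) (EFin \o (f \o rVT)).
Proof.
move=> [mD bD] [mf [C fC]]; apply: measurable_bounded_integrable => //.
  exact: lebesgue_tuple_bounded.
exists C; split; first exact: num_real.
by move=> M CM t /= Dt; rewrite (le_trans (fC _ Dt))// ltW.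
Qed.

Lemma integral_rV_lin D : bounded_meas_set D ->
  linear_on (bounded_meas D) (integral_rV D).
Proof.
move=> bD c f g Df Dg; rewrite /integral_rV; have [mD _] := bD.
have Dcf : bounded_meas D (fun x => c * f x).
  by apply: bounded_measM => //; exact: bounded_meas_cst.
rewrite RintegralD//.
- by rewrite RintegralZl//; exact: bounded_meas_integrable.
- exact: bounded_meas_integrable Dcf.
- exact: bounded_meas_integrable.
Qed.

Lemma eq_integral_rV D f g : (forall x, D x -> f x = g x) ->
  integral_rV D f = integral_rV D g.
Proof. by move=> fg; apply: eq_Rintegral => t /set_mem; exact: fg. Qed.

Lemma L2dot_bounded_meas_bilin D : bounded_meas_set D ->
  bilinear_on (bounded_meas D) (L2dot D).
Proof.
move=> bD; apply: sym_bilinear_on => [|g Dg]; first exact: L2dotC.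
move=> c f h Df Dh; rewrite /L2dot -integral_rV_lin//; last 2 first.
- exact: bounded_measM.
- exact: bounded_measM.
by apply: eq_integral_rV => x _; rewrite mulrDl mulrA.
Qed.

Lemma bounded_meas_eq D f g : (forall x, D x -> f x = g x) ->
  bounded_meas D f -> bounded_meas D g.
Proof.
move=> fg [mf [C fC]]; split; last by exists C => x Dx; rewrite -fg// fC.
by apply: eq_measurable_fun mf => t /set_mem Dt; exact: fg.
Qed.

Lemma measurable_continuous_rV f : continuous f -> measurable_fun setT (f \o rVT).
Proof.
move=> /continuousP cf.
apply: (measurability _ (RGenOpens.measurableE R)) => _ [_ [a [b ->]] <-].
rewrite setTI -[X in measurable X]/(rVT @^-1` (f @^-1` `]a, b[%classic)).
by apply: measurable_open_rV; apply: cf; exact: itv_open.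
Qed.

Lemma compact_closure_bounded D : bounded_set D -> compact (closure D).
Proof.
move=> [C [Cr DC]]; apply: bounded_closed_compact; last exact: closed_closure.
exists C; split=> // M CM.
have : closed [set x : E | `|x| <= M].
  by apply: (@closed_comp _ _ (fun x : E => `|x| : R) [set r | r <= M]) => [x _|];
    [exact: norm_continuous|exact: closed_le].
by move/closure_id ->; apply: closure_subset; exact: DC.
Qed.

Lemma continuous_bounded_on D f : bounded_set D -> continuous f ->
  exists C, forall x, D x -> `|f x| <= C.
Proof.
move=> bD cf.
have : bounded_set (f @` closure D).
  apply: compact_bounded; apply: continuous_compact.
    exact: continuous_subspaceT.
  exact: compact_closure_bounded.
move=> [C [_ fC]]; exists (C + 1) => x Dx.
by apply: (fC (C + 1)); rewrite ?ltrDl//; exists x => //; exact: subset_closure.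
Qed.

(** Meant for the derivative of [Phi] composed with a discrete function: the values of [f] on [D]
    stay in a compact interval, on which [h] is bounded. *)
Lemma bounded_meas_comp D f (h : R -> R) : continuous h -> bounded_meas D f ->
  bounded_meas D (h \o f).
Proof.
move=> ch [mf [C fC]]; split.
  by apply: (measurableT_comp _ mf); exact: continuous_measurable_fun.
have : bounded_set (h @` `[- C, C]%classic).
  apply: compact_bounded; apply: continuous_compact; last exact: segment_compact.
  exact: continuous_subspaceT.
move=> [C' [_ hC]]; exists (C' + 1) => x Dx.
apply: (hC (C' + 1)); rewrite ?ltrDl//; exists (f x) => //=.
by rewrite in_itv /= -ler_norml fC.
Qed.

Lemma indic_rV_of_tuple K : (\1_K : fct) \o rVT = \1_(rVT @^-1` K).
Proof. by apply/funext => t; rewrite /= !indicE. Qed.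

Lemma bounded_meas_indic D K : open K -> bounded_meas D (\1_K : fct).
Proof.
move=> oK; split; last first.
  by exists 1 => y _; rewrite indicE; case: (_ \in _); rewrite ?normr1 ?normr0.
rewrite indic_rV_of_tuple; apply: measurable_indic; exact: measurable_open_rV.
Qed.

(** The extension is to the whole space, hence bounded on bounded sets, and its values on the
    boundary of [D] are the traces. *)
Definition continuous_ext D : set fct :=
  [set f : fct | exists2 g : fct, continuous g & forall x, D x -> f x = g x].

Lemma continuous_ext_bounded_meas D f :
  bounded_meas_set D -> continuous_ext D f -> bounded_meas D f.
Proof.
move=> [mD bD] [g cg fg]; apply: (@bounded_meas_eq _ g) => [x /fg//|].
split; last exact: continuous_bounded_on.
by apply: measurable_funS (measurable_continuous_rV cg).
Qed.

Lemma continuous_extD D f g : continuous_ext D f -> continuous_ext D g ->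
  continuous_ext D (fun x => f x + g x).
Proof.
move=> [f' cf ff] [g' cg gg]; exists (fun x => f' x + g' x).
  by move=> x; apply: continuousD; [exact: cf|exact: cg].
by move=> x Dx; rewrite ff// gg.
Qed.

Lemma continuous_extM D f g : continuous_ext D f -> continuous_ext D g ->
  continuous_ext D (fun x => f x * g x).
Proof.
move=> [f' cf ff] [g' cg gg]; exists (fun x => f' x * g' x).
  by move=> x; apply: continuousM; [exact: cf|exact: cg].
by move=> x Dx; rewrite ff// gg.
Qed.

Lemma continuous_ext_cst D (c : R) : continuous_ext D (cst c).
Proof. by exists (cst c) => //; exact: cst_continuous. Qed.

Lemma continuous_ext_lin D : lin_closed (continuous_ext D).
Proof.
move=> c f g Df Dg; apply: continuous_extD => //; apply: continuous_extM => //.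
exact: continuous_ext_cst.
Qed.

Lemma continuous_ext_sum D (I : Type) (r : seq I) (F : I -> fct) :
  (forall i, continuous_ext D (F i)) ->
  continuous_ext D (fun x => \sum_(i <- r) F i x).
Proof.
move=> DF; elim: r => [|i r IH].
  rewrite (_ : (fun _ => _) = cst 0); first exact: continuous_ext_cst.
  by apply/funext => x; rewrite big_nil.
rewrite (_ : (fun _ => _) = fun x => F i x + \sum_(i <- r) F i x).
  exact: continuous_extD.
by apply/funext => x; rewrite big_cons.
Qed.

(** Membership in the closure makes the filter of neighbourhoods within [K] proper, so the limit is
    unique and equals the value of the extension. *)
Lemma trace_ext K f g x : continuous g -> (forall y, K y -> f y = g y) ->
  closure K x -> trace K f x = g x.
Proof.
move=> cg fg Kx.
have PF : ProperFilter (within K (nbhs x)) by exact: within_nbhs_proper.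
apply: cvg_lim => //.
have gg : g y @[y --> within K (nbhs x)] --> g x.
  by apply: cvg_within_filter; exact: cg.
apply: cvg_trans gg; apply: near_eq_cvg.
by rewrite near_withinE; apply: nearW => y /fg ->.
Qed.

(** If [f x] were nonzero, continuity would keep the square of [f] above [de] on a small ball inside
    [K], and the integral would be at least [de] times the positive measure of that ball. *)
Lemma L2dot_eq0_open D K f : bounded_meas_set D -> bounded_meas D f ->
  open K -> K `<=` D -> continuous_ext K f -> L2dot D f f = 0 ->
  forall x, K x -> f x = 0.
Proof.
move=> bD Df oK KD [g cg fg] f0 x Kx; rewrite fg//; apply/eqP/negPn/negP => gx0.
have gx2 : 0 < `|g x| / 2 by rewrite divr_gt0// normr_gt0.
pose de := (`|g x| / 2) ^+ 2.
have de0 : 0 < de by rewrite exprn_gt0.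
have [e /= e0 xe] : exists2 e : R, 0 < e & forall y, ball x e y -> K y /\ de <= g y * g y.
  have : \forall y \near x, K y /\ de <= g y * g y.
    near=> y; split; first by near: y; exact: oK.
    have gy : `|g x - g y| < `|g x| / 2.
      by near: y; move: gx2; have /cvgrPdist_lt := cg x => /[apply].
    rewrite -expr2 -(real_normK (num_real (g y))) /de ler_sqr ?nnegrE ?(ltW gx2)//.
    have := lerB_dist (g x) (g x - g y); rewrite subKr => h.
    by lra.
  by move=> /nbhs_ballP[e e0 xe]; exists e.
have [mD bdD] := bD; have bK : ball x e `<=` D by move=> y /xe[/KD].
pose h (y : E) : R := de * \1_(ball x e) y.
have ind1 := indic_rV_of_tuple (ball x e).
have D1 : bounded_meas D (\1_(ball x e) : fct).
  by apply: bounded_meas_indic; exact: ball_open.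
have : integral_rV D h <= L2dot D f f.
  apply: le_Rintegral => //.
  - apply: (bounded_meas_integrable (f := h)) => //.
    by apply: bounded_measM => //; exact: bounded_meas_cst.
  - apply: (bounded_meas_integrable (f := fun x => f x * f x)) => //.
    exact: bounded_measM.
  move=> t _; rewrite /h indicE; case: (boolP (_ \in _)) => [/set_mem/xe[Kt]|_].
    by rewrite mulr1 fg.
  by rewrite mulr0 -expr2 sqr_ge0.
rewrite f0 leNgt => /negP; apply.
rewrite /integral_rV RintegralZl//; last first.
  exact: (bounded_meas_integrable (f := \1_(ball x e))).
rewrite mulr_gt0// -[X in Rintegral _ _ X]/((\1_(ball x e) : fct) \o rVT) ind1.
rewrite /Rintegral.
rewrite integral_indic//; last exact: measurable_rV_ball.
rewrite setIidl//; last by move=> t; exact: bK.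
by rewrite [X in fine X](lebesgue_tuple_ball x e0) exprn_gt0// mulrn_wgt0.
Unshelve. all: by end_near. Qed.

End BoundedMeasurable.

(** * Piecewise polynomials *)

Section Smooth.
Context (R : realType) (n : nat).
Import -(notations) mpoly.
Local Notation E := 'rV[R]_n.
Local Notation fct := (E -> R).
Implicit Types (K : set E) (f g : fct).

(** Regularity one direction at a time: enough for gradients and normal derivatives, and stable
    under sums and products, hence true of polynomials. *)
Definition gateaux_C1 f : Prop :=
  [/\ continuous f, forall v x, derivable f x v & forall v, continuous ('D_v f)].

Lemma continuous_funD f g : continuous f -> continuous g ->
  continuous (fun x => f x + g x).
Proof. by move=> cf cg x; apply: continuousD; [exact: cf|exact: cg]. Qed.

Lemma continuous_funM f g : continuous f -> continuous g ->
  continuous (fun x => f x * g x).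
Proof. by move=> cf cg x; apply: continuousM; [exact: cf|exact: cg]. Qed.

Lemma gateaux_C1_cst (c : R) : gateaux_C1 (cst c).
Proof.
split=> [|v x|v]; [exact: cst_continuous|exact: derivable_cst|].
rewrite (_ : 'D_v _ = cst 0); first exact: cst_continuous.
by apply/funext => x; rewrite derive_cst.
Qed.

Lemma gateaux_C1D f g : gateaux_C1 f -> gateaux_C1 g ->
  gateaux_C1 (fun x => f x + g x).
Proof.
move=> [cf df Df] [cg dg Dg]; split=> [|v x|v].
- exact: continuous_funD.
- by apply: (@derivableD _ _ _ f g).
rewrite (_ : 'D_v _ = fun x => 'D_v f x + 'D_v g x); last first.
  by apply/funext => x; rewrite -deriveD.
exact: continuous_funD (Df v) (Dg v).
Qed.

Lemma gateaux_C1M f g : gateaux_C1 f -> gateaux_C1 g ->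
  gateaux_C1 (fun x => f x * g x).
Proof.
move=> [cf df Df] [cg dg Dg]; split=> [|v x|v].
- exact: continuous_funM.
- by apply: (@derivableM _ _ f g).
rewrite (_ : 'D_v _ = fun x => f x * 'D_v g x + g x * 'D_v f x); last first.
  by apply/funext => x; rewrite -[RHS](@deriveM _ _ f g).
exact: continuous_funD (continuous_funM cf (Dg v)) (continuous_funM cg (Df v)).
Qed.

Lemma gateaux_C1_coord (j : 'I_n) : gateaux_C1 (fun x : E => x 0 j).
Proof.
have dc (v x : E) : derivable (fun x : E => x 0 j) x v.
  by apply: diff_derivable; exact: differentiable_coord.
split=> // [|v]; first exact: coord_continuous.
rewrite (_ : 'D_v _ = cst (v 0 j)); first exact: cst_continuous.
apply/funext => x; apply: cvg_lim => //.
(* The difference quotient of a coordinate is constant as soon as [h] is nonzero. *)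
apply: (@cvg_near_cst _ _ (v 0 j)) => //.
near=> h; rewrite /= !mxE addrK /= [LHS]mulrA mulVf ?mul1r//.
by near: h; exact: nbhs_dnbhs_neq.
Unshelve. all: by end_near. Qed.

Lemma gateaux_C1X f m : gateaux_C1 f -> gateaux_C1 (fun x => f x ^+ m).
Proof.
move=> Cf; elim: m => [|m IH]; first exact: gateaux_C1_cst.
rewrite (_ : (fun _ => _) = fun x => f x * f x ^+ m); first exact: gateaux_C1M.
by apply/funext => x; rewrite exprS.
Qed.

Lemma gateaux_C1_meval (p : mpoly n R) :
  gateaux_C1 (fun x => meval (fun j => x 0 j) p).
Proof.
under eq_fun do rewrite mevalE.
elim: (msupp p) => [|m r IH].
  rewrite (_ : (fun _ => _) = cst 0); first exact: gateaux_C1_cst.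
  by apply/funext => x; rewrite big_nil.
under eq_fun do rewrite big_cons.
apply: gateaux_C1D => //; apply: gateaux_C1M; first exact: gateaux_C1_cst.
elim: (index_enum _) => [|i s IHs].
  rewrite (_ : (fun _ => _) = cst 1); first exact: gateaux_C1_cst.
  by apply/funext => x; rewrite big_nil.
under eq_fun do rewrite big_cons.
by apply: gateaux_C1M => //; apply: gateaux_C1X; exact: gateaux_C1_coord.
Qed.

Section Open.
Variables (K : set E) (oK : open K) (f g : fct).
Hypotheses (Cg : gateaux_C1 g) (fg : forall x, K x -> f x = g x).

(** Openness of [K] upgrades equality on [K] to equality near each of its points, which is what
    derivatives depend on. *)
Let near_fg x : K x -> {near x, g =1 f}.
Proof. by move=> Kx; near=> y; rewrite fg//; near: y; exact: oK.
Unshelve. all: by end_near. Qed.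

Lemma derivable_open x v : K x -> derivable f x v.
Proof.
by move=> Kx; apply: near_eq_derivable (near_fg Kx) _; case: Cg.
Qed.

Lemma derive_open x v : K x -> 'D_v f x = 'D_v g x.
Proof. by move=> Kx; rewrite (near_eq_derive v (near_fg Kx)). Qed.

End Open.

Lemma continuous_rV (T : topologicalType) m (F : T -> 'rV[R]_m) :
  (forall j, continuous (fun x => F x 0 j)) -> continuous F.
Proof.
move=> cF x A [P xP PA].
have : \forall y \near x, forall j : 'I_m, P 0 j (F y 0 j).
  by apply: filter_forall => j; exact: (cF j x _ (xP 0 j)).
by apply: filterS => y Py; apply: PA => i j; rewrite ord1.
Qed.

Lemma continuous_mulmxr m (Q : 'M[R]_(n, m)) : continuous (fun x : E => x *m Q).
Proof.
apply: continuous_rV => j.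
rewrite (_ : (fun x => _) = fun x : E => \sum_k x 0 k * Q k j); last first.
  by apply/funext => x; rewrite mxE.
elim: (index_enum _) => [|i r IH].
  rewrite (_ : (fun _ => _) = cst 0); first exact: cst_continuous.
  by apply/funext => x; rewrite big_nil.
rewrite (_ : (fun _ => _) =
    fun x : E => x 0 i * Q i j + \sum_(k <- r) x 0 k * Q k j).
  apply: continuous_funD => //; apply: continuous_funM; first exact: coord_continuous.
  exact: (@cst_continuous _ _ (Q i j)).
by apply/funext => x; rewrite big_cons.
Qed.

End Smooth.

(** * The broken polynomial space: finite dimension and definiteness of the inner product *)

Section DGSpace.
Context (R : realType) (d k : nat) (M : mesh R d).
Import -(notations) mpoly.
Local Notation E := 'rV[R]_d.+1.
Local Notation V := (dg_space M k).

Lemma dg_space0 : V (cst 0).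
Proof.
split=> [i|//]; exists 0; first by rewrite mmeasure0.
by move=> x _; rewrite meval0.
Qed.

Lemma dg_space_lin : lin_closed V.
Proof.
move=> c f g [fp f0] [gp g0]; split=> [i|x nx]; last first.
  by rewrite f0// g0// mulr0 addr0.
have [p pk fE] := fp i; have [q qk gE] := gp i.
exists (c *: p + q).
  rewrite (leq_trans (mmeasureD_le _ _ _))// geq_max qk andbT.
  exact: leq_trans (mmeasureZ_le _ _ _) pk.
by move=> x Kx; rewrite mevalD mevalZ fE// gE.
Qed.

Lemma dg_space_C1 v i : V v ->
  exists2 g : E -> R, gateaux_C1 g & forall x, elem M i x -> v x = g x.
Proof.
move=> [vp _]; have [p _ vE] := vp i.
by exists (fun x => meval (fun j => x 0 j) p) => //; exact: gateaux_C1_meval.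
Qed.

Lemma dg_space_continuous_ext v i : V v -> continuous_ext (elem M i) v.
Proof. by move=> /(dg_space_C1 i)[g [cg _ _] vg]; exists g. Qed.

(** [bmultinom d.+1 k.+1] contains the exponents of degree strictly below [k.+1], i.e. at most [k],
    in accordance with [mmeasure mdeg] being the degree plus one. *)
Definition dg_basis (s : 'I_(nelem M) * bmultinom d.+1 k.+1) : E -> R :=
  fun x => \1_(elem M s.1) x *
    meval (fun j => x 0 j) (mpolyX R (bmnm s.2)).

Hypothesis disjoint_elem : trivIset setT (elem M).

Lemma dg_basis_in s : V (dg_basis s).
Proof.
split=> [i|x nx]; last by rewrite /dg_basis indicE memNset ?mul0r//; exact: nx.
have [<-|si] := eqVneq s.1 i.
  exists (mpolyX R (bmnm s.2)).
    by rewrite mmeasureX; exact: bmdeg.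
  by move=> x Kx; rewrite /dg_basis indicE mem_set// mul1r.
exists 0; first by rewrite mmeasure0.
move=> x Kx; rewrite meval0 /dg_basis indicE memNset ?mul0r// => Ksx.
by move/eqP: si; apply; apply: disjoint_elem => //; exists x.
Qed.

Lemma dg_span v : V v -> exists c, v = fun x => \sum_s c s * dg_basis s x.
Proof.
move=> [vp v0].
have /choice[p pP] : forall i, exists p : mpoly d.+1 R,
    (mmeasure mdeg p <= k.+1)%N /\
    forall x, elem M i x -> v x = meval (fun j => x 0 j) p.
  by move=> i; have [p] := vp i; exists p.
exists (fun s => mcoeff (bmnm s.2) (p s.1)); apply/funext => x.
pose F i m := mcoeff (bmnm m) (p i) * dg_basis (i, m) x.
rewrite -(pair_bigA _ F) /= /F.
have F0 i : ~ elem M i x ->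
    \sum_m mcoeff (bmnm m) (p i) * dg_basis (i, m) x = 0.
  by move=> nKx; rewrite big1// => m _; rewrite /dg_basis indicE memNset// mul0r mulr0.
(* By disjointness at most one element contains [x], and only its monomials contribute; off all
   elements both sides are 0, by the normalization in [dg_space]. *)
have [[i Kx]|nK] := pselect (exists i, elem M i x); last first.
  rewrite v0; last by move=> i Kx; apply: nK; exists i.
  by rewrite big1// => i _; rewrite F0// => Kx; apply: nK; exists i.
rewrite (bigD1 i)//= [X in _ + X]big1 ?addr0; last first.
  move=> i' i'i; rewrite F0// => Kx'; move/eqP: i'i; apply.
  by apply: disjoint_elem => //; exists x.
have [pk ->//] := pP i.
rewrite {1}(mpolywE pk) raddf_sum /=; apply: eq_bigr => m _.
by rewrite mevalZ /dg_basis indicE mem_set//= mul1r.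
Qed.

Lemma dg_space_finite_dim : finite_dim V.
Proof.
exists #|{: 'I_(nelem M) * bmultinom d.+1 k.+1}|.
exists (fun i => dg_basis (enum_val i)); split=> [i|v Vv]; first exact: dg_basis_in.
have [c ->] := dg_span Vv; exists (fun i => c (enum_val i)).
by apply/funext => x; rewrite (reindex _ (onW_bij _ (@enum_val_bij _))).
Qed.

Variable Omega : set E.
Hypotheses (oOmega : open Omega) (bOmega : bounded_set Omega).
Hypothesis open_elem : forall i, open (elem M i) /\ elem M i `<=` Omega.

(** The spanning family reduces this to indicators of open sets and to polynomials, which are
    continuous. *)
Lemma dg_space_bounded_meas : V `<=` bounded_meas Omega.
Proof.
move=> v /dg_span[c ->].
have bO := open_bounded_meas_set oOmega bOmega.
have cO : lin_closed (bounded_meas Omega) by exact: bounded_meas_lin.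
elim: (index_enum _) => [|s r IH].
  rewrite (_ : (fun _ => _) = cst 0); first exact: bounded_meas_cst.
  by apply/funext => x; rewrite big_nil.
rewrite (_ : (fun _ => _) =
    fun x => c s * dg_basis s x + \sum_(s <- r) c s * dg_basis s x).
  apply: cO => //; apply: bounded_measM.
    by apply: bounded_meas_indic; case: (open_elem s.1).
  apply: continuous_ext_bounded_meas => //.
  by have [cp _ _] := gateaux_C1_meval (mpolyX R (bmnm s.2)); eexists.
by apply/funext => x; rewrite big_cons.
Qed.

(** The conclusion is an equality of functions, not one almost everywhere: continuity handles the
    points inside elements, the normalization of [dg_space] all others. *)
Lemma L2dot_dg_def v : V v -> L2dot Omega v v = 0 -> v = cst 0.
Proof.
move=> Vv v0; apply/funext => x.
have [[i Kx]|nK] := pselect (exists i, elem M i x); last first.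
  by case: Vv => _ -> // i Kx; apply: nK; exists i.
have [oK KO] := open_elem i.
apply: (L2dot_eq0_open _ _ oK KO _ v0) => //.
- exact: open_bounded_meas_set.
- exact: dg_space_bounded_meas.
- exact: dg_space_continuous_ext.
Qed.

Lemma sav_b_bounded_meas (Phi : R -> R) (B : R) v : continuous (derive1 Phi) ->
  V v -> bounded_meas Omega (sav_b Omega Phi B v).
Proof.
move=> cPhi /dg_space_bounded_meas Ov; apply: bounded_measM.
  exact: (bounded_meas_comp cPhi).
exact: bounded_meas_cst.
Qed.

End DGSpace.

(** * The DG bilinear form *)

Section SmoothExt.
Context (R : realType) (n : nat).
Local Notation E := 'rV[R]_n.
Local Notation fct := (E -> R).
Implicit Types (K : set E) (f g : fct).

Definition C1_ext K : set fct :=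
  [set f : fct | exists2 g : fct, gateaux_C1 g & forall x, K x -> f x = g x].

Lemma C1_ext_continuous K f : C1_ext K f -> continuous_ext K f.
Proof. by move=> [g [cg _ _] fg]; exists g. Qed.

Lemma C1_ext_derive K f v : open K -> C1_ext K f -> continuous_ext K ('D_v f).
Proof.
move=> oK [g Cg fg]; exists ('D_v g); first by case: Cg.
by move=> x; exact: derive_open.
Qed.

Lemma derive_lin K (c : R) f g v x : open K -> C1_ext K f -> C1_ext K g -> K x ->
  'D_v (fun x => c * f x + g x) x = c * 'D_v f x + 'D_v g x.
Proof.
move=> oK [f' Cf ff] [g' Cg gg] Kx.
have df : derivable f x v by apply: (derivable_open oK Cf ff).
have dg : derivable g x v by apply: (derivable_open oK Cg gg).
have dcf := derivableM (derivable_cst c x v) df.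
rewrite -(deriveMl c df); exact: (deriveD dcf dg).
Qed.

(** Only the values of [h] inside [K] are prescribed, so that it may be the derivative of a
    combination, which is known to split only on the elements. *)
Lemma trace_lin K (c : R) f g h x : closure K x ->
  continuous_ext K f -> continuous_ext K g ->
  (forall y, K y -> h y = c * f y + g y) ->
  trace K h x = c * trace K f x + trace K g x.
Proof.
move=> Kx Kf Kg hE.
have [f' cf ff] := Kf; have [g' cg gg] := Kg.
rewrite (trace_ext cf ff Kx) (trace_ext cg gg Kx).
apply: (@trace_ext _ _ _ _ (fun y => c * f' y + g' y)) => //.
  apply: (continuous_funD _ cg); apply: (continuous_funM _ cf).
  exact: (@cst_continuous _ _ c).
by move=> y Ky; rewrite hE// ff// gg.
Qed.

Lemma trace_continuous_ext K S s f : (forall x, S x -> closure K (x + s)) ->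
  continuous_ext K f -> continuous_ext S (fun x => trace K f (x + s)).
Proof.
move=> SK [g cg fg].
have cs : continuous (fun x : E => x + s).
  by move=> x; apply: continuousD; [exact: cvg_id|exact: (@cst_continuous _ _ s)].
exists (g \o (fun x : E => x + s)) => [x|x Sx].
  by apply: continuous_comp; [exact: cs|exact: cg].
by rewrite (trace_ext cg fg (SK _ Sx)).
Qed.

Lemma linear_on_add (V : set fct) (l1 l2 : fct -> R) :
  linear_on V l1 -> linear_on V l2 -> linear_on V (fun f => l1 f + l2 f).
Proof.
by move=> L1 L2 c f g Vf Vg; rewrite L1// L2// mulrDr addrACA.
Qed.

Lemma linear_on_mul (V : set fct) (a : R) (l : fct -> R) :
  linear_on V l -> linear_on V (fun f => a * l f).
Proof. by move=> L c f g Vf Vg; rewrite L// mulrDr mulrCA. Qed.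

Lemma linear_on_sum_form (V : set fct) N (l : 'I_N -> fct -> R) :
  (forall i, linear_on V (l i)) -> linear_on V (fun f => \sum_i l i f).
Proof.
move=> L c f g Vf Vg; rewrite mulr_sumr -big_split /=.
by apply: eq_bigr => i _; exact: L.
Qed.

Lemma sub_linear_on (V W : set fct) (l : fct -> R) :
  V `<=` W -> linear_on W l -> linear_on V l.
Proof. by move=> VW L c f g Vf Vg; apply: L; exact: VW. Qed.

End SmoothExt.

(** * Volume and face terms of the form *)

Section FormLinear.
Context (R : realType) (d : nat).
Local Notation E := 'rV[R]_d.+1.
Local Notation fct := (E -> R).

Lemma volume_form_lin (K : set E) (a : R) (v : fct) :
  open K -> bounded_set K -> C1_ext K v ->
  linear_on (C1_ext K)
    (fun w => integral_rV K (fun x => grad_dot w v x - a / 2 * w x * v x)).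
Proof.
move=> oK bK Kv c f g Kf Kg; have mK := open_bounded_meas_set oK bK.
pose F (w : fct) x := grad_dot w v x - a / 2 * w x * v x.
have bF w : C1_ext K w -> bounded_meas K (F w).
  move=> Kw; apply: continuous_ext_bounded_meas => //.
  apply: continuous_extD.
    apply: continuous_ext_sum => j; apply: continuous_extM; exact: C1_ext_derive.
  rewrite (_ : (fun x => _) = fun x => - (a / 2) * (w x * v x)).
    apply: continuous_extM; first exact: continuous_ext_cst.
    by apply: continuous_extM; exact: C1_ext_continuous.
  by apply/funext => x; rewrite mulrA !mulNr.
rewrite -(integral_rV_lin mK); [|exact: bF..].
apply: eq_integral_rV => x Kx; rewrite /F.
rewrite (_ : grad_dot _ v x = c * grad_dot f v x + grad_dot g v x); first by ring.
rewrite /grad_dot mulr_sumr -big_split /=; apply: eq_bigr => j _.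
by rewrite (derive_lin c _ oK Kf Kg Kx) mulrDl mulrA.
Qed.

Section Face.
Context (m : nat) (K : 'I_m -> set E) (F : face R d m).
Hypotheses (Fface : is_face K F) (bF : bounded_set (fset F)).

(** Moving from [x] against the normal by a small positive [t] enters the first element, and these
    points tend to [x]. *)
Lemma face_closure1 x : fset F x -> closure (K (fel1 F)) x.
Proof.
move=> Fx B xB; have [_ _ /(_ x Fx) near1] := Fface.
have xt : (x - t *: fnormal F) @[t --> 0^'+] --> x.
  apply: cvg_at_right_filter.
  rewrite [X in _ --> X](_ : x = x - 0 *: fnormal F); last by rewrite scale0r subr0.
  by apply: cvgB; [exact: cvg_cst|exact: (@scalel_continuous _ _ (fnormal F) 0)].
have [t [[K1 _] Bt]] : exists t, (K (fel1 F) (x - t *: fnormal F) /\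
    K (fel2 F) (x + fshift F + t *: fnormal F)) /\ B (x - t *: fnormal F).
  by apply: (@filter_ex _ (0^'+)); apply: filterI => //; exact: (xt B xB).
by exists (x - t *: fnormal F).
Qed.

Lemma face_closure2 x : fset F x -> closure (K (fel2 F)) (x + fshift F).
Proof.
move=> Fx B xB; have [_ _ /(_ x Fx) near1] := Fface.
have xt : (x + fshift F + t *: fnormal F) @[t --> 0^'+] --> x + fshift F.
  apply: cvg_at_right_filter.
  rewrite [X in _ --> X](_ : x + fshift F = x + fshift F + 0 *: fnormal F).
    by apply: cvgD; [exact: cvg_cst|exact: (@scalel_continuous _ _ (fnormal F) 0)].
  by rewrite scale0r addr0.
have [t [[_ K2] Bt]] : exists t, (K (fel1 F) (x - t *: fnormal F) /\
    K (fel2 F) (x + fshift F + t *: fnormal F)) /\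
    B (x + fshift F + t *: fnormal F).
  by apply: (@filter_ex _ (0^'+)); apply: filterI => //; exact: (xt B xB).
by exists (x + fshift F + t *: fnormal F).
Qed.

Lemma continuous_fpoint : continuous (fpoint F).
Proof.
rewrite -[fpoint F]/(fun y : 'rV[R]_d => forig F + y *m fframe F) => y.
apply: (@cvgD _ _ _ (nbhs y) _ (cst (forig F)) (fun y => y *m fframe F)).
  exact: cvg_cst.
exact: continuous_mulmxr.
Qed.

(** Orthonormality of the rows of [fframe F] makes [h] a continuous left inverse of [fpoint F],
    which carries the bound on the face back to its parameters. *)
Lemma bounded_fparam : bounded_set (fparam F).
Proof.
pose h (x : E) := (x - forig F) *m (fframe F)^T.
have ch : continuous h.
  move=> x; apply: (@continuous_comp _ _ _ (fun x : E => x - forig F)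
    (fun x => x *m (fframe F)^T)); last exact: continuous_mulmxr.
  by apply: continuousB; [exact: cvg_id|exact: (@cst_continuous _ _ (forig F))].
have : bounded_set (h @` closure (fset F)).
  apply: compact_bounded; apply: continuous_compact.
    exact: continuous_subspaceT.
  exact: compact_closure_bounded.
move=> [C [Cr hC]]; exists C; split=> // N CN y Fy; apply: (hC N CN).
exists (fpoint F y); first by apply: subset_closure; exists y.
have [_ [QQ _ _] _] := Fface.
by rewrite /h /fpoint addrC addKr -mulmxA QQ mulmx1.
Qed.

Lemma fparam_bounded_meas_set : bounded_meas_set (fparam F).
Proof.
by have [[oF _ _] _ _] := Fface; apply: open_bounded_meas_set => //;
  exact: bounded_fparam.
Qed.

Lemma continuous_ext_fpoint g : continuous_ext (fset F) g ->
  continuous_ext (fparam F) (g \o fpoint F).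
Proof.
move=> [h ch gh]; exists (h \o fpoint F) => [y|y Fy].
  by apply: continuous_comp; [exact: continuous_fpoint|exact: ch].
by apply: gh; exists y.
Qed.
End Face.

Section FaceForm.
Context (M : mesh R d) (F : face R d (nelem M)).
Hypotheses (oK : forall i, open (elem M i)) (Fface : is_face (elem M) F).
Hypothesis bF : bounded_set (fset F).
Local Notation K1 := (elem M (fel1 F)).
Local Notation K2 := (elem M (fel2 F)).

(** The two extensions may differ on the face, which is what allows a nonzero jump. *)
Let ext2 : set fct := continuous_ext K1 `&` continuous_ext K2.

Lemma trace1_ext f : ext2 f -> continuous_ext (fset F) (trace1 F f).
Proof.
move=> [f1 _]; rewrite (_ : trace1 F f = fun x => trace K1 f (x + 0)).
  by apply: trace_continuous_ext => // x Fx; rewrite addr0; exact: (face_closure1 Fface).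
by apply/funext => x; rewrite addr0.
Qed.

Lemma trace2_ext f : ext2 f -> continuous_ext (fset F) (trace2 F f).
Proof.
by move=> [_ f2]; apply: trace_continuous_ext => // x; exact: (face_closure2 Fface).
Qed.

Lemma avg_ext f : ext2 f -> continuous_ext (fset F) (avg F f).
Proof.
move=> ef; apply: continuous_extM; last exact: continuous_ext_cst.
by apply: continuous_extD; [exact: trace1_ext|exact: trace2_ext].
Qed.

Lemma jump_ext f : ext2 f -> continuous_ext (fset F) (jump F f).
Proof.
move=> ef; rewrite (_ : jump F f = fun x => -1 * trace1 F f x + trace2 F f x).
  by apply: continuous_ext_lin; [exact: trace1_ext|exact: trace2_ext].
by apply/funext => x; rewrite mulN1r addrC.
Qed.

Section Linear.
Variables (c : R) (f g h : fct) (x : E).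
Hypotheses (ef : ext2 f) (eg : ext2 g) (Fx : fset F x).
Hypothesis hE : forall y, K1 y \/ K2 y -> h y = c * f y + g y.

Lemma trace1_lin : trace1 F h x = c * trace1 F f x + trace1 F g x.
Proof.
case: ef eg => [f1 _] [g1 _]; apply: trace_lin => //.
  exact: (face_closure1 Fface).
by move=> y K1y; apply: hE; left.
Qed.

Lemma trace2_lin : trace2 F h x = c * trace2 F f x + trace2 F g x.
Proof.
case: ef eg => [_ f2] [_ g2]; apply: trace_lin => //.
  exact: (face_closure2 Fface).
by move=> y K2y; apply: hE; right.
Qed.

Lemma avg_lin : avg F h x = c * avg F f x + avg F g x.
Proof. by rewrite /avg trace1_lin trace2_lin; ring. Qed.

Lemma jump_lin : jump F h x = c * jump F f x + jump F g x.
Proof. by rewrite /jump trace1_lin trace2_lin; ring. Qed.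

End Linear.

Lemma face_form_lin v : (forall i, C1_ext (elem M i) v) ->
  linear_on [set w : fct | forall i, C1_ext (elem M i) w]
    (fun w => face_form F w v).
Proof.
have ext w : (forall i, C1_ext (elem M i) w) -> ext2 w.
  by move=> Cw; split; exact: C1_ext_continuous.
have dext w : (forall i, C1_ext (elem M i) w) -> ext2 (dnormal F w).
  by move=> Cw; split; exact: C1_ext_derive.
move=> Cv c f g Cf Cg; pose G (w : fct) := fun x =>
  avg F (dnormal F w) x * jump F v x + jump F w x * avg F (dnormal F v) x.
have bG w : (forall i, C1_ext (elem M i) w) ->
    bounded_meas (fparam F) (G w \o fpoint F).
  move=> Cw; apply: continuous_ext_bounded_meas.
    exact: (fparam_bounded_meas_set Fface).
  apply: continuous_ext_fpoint; apply: continuous_extD; apply: continuous_extM.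
  - by apply: avg_ext; exact: dext.
  - by apply: jump_ext; exact: ext.
  - by apply: jump_ext; exact: ext.
  - by apply: avg_ext; exact: dext.
rewrite -[RHS](integral_rV_lin (fparam_bounded_meas_set Fface bF) c (bG _ Cf) (bG _ Cg)).
apply: eq_integral_rV => y Fy; rewrite /= /G.
have Fx : fset F (fpoint F y) by exists y.
have -> : avg F (dnormal F (fun x => c * f x + g x)) (fpoint F y) =
    c * avg F (dnormal F f) (fpoint F y) + avg F (dnormal F g) (fpoint F y).
  apply: avg_lin => // [||z Kz]; [exact: dext|exact: dext|].
  (* The derivative of the combination splits inside an element, so one containing [z] is singled
     out. *)
  have [i Ki] : exists i, elem M i z by case: Kz => Kz; eexists; exact: Kz.
  exact: (derive_lin c (fnormal F) (@oK i) (Cf i) (Cg i) Ki).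
have -> : jump F (fun x => c * f x + g x) (fpoint F y) =
    c * jump F f (fpoint F y) + jump F g (fpoint F y).
  by apply: jump_lin => //; exact: ext.
have alg (a1 a2 j b1 b2 e : R) : (c * a1 + a2) * j + (c * b1 + b2) * e =
    c * (a1 * j + b1 * e) + (a2 * j + b2 * e) by ring.
exact: alg.
Qed.

End FaceForm.

Lemma dg_formC (M : mesh R d) (a : R)
    (bc : boundary_condition R d (nelem M)) (w v : fct) :
  dg_form bc a w v = dg_form bc a v w.
Proof.
have volC : \sum_(i < nelem M) integral_rV (elem M i)
      (fun x => grad_dot w v x - a / 2 * w x * v x) =
    \sum_(i < nelem M) integral_rV (elem M i)
      (fun x => grad_dot v w x - a / 2 * v x * w x).
  apply: eq_bigr => i _; apply: eq_integral_rV => x _.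
  rewrite -!mulrA [w x * _]mulrC (_ : grad_dot w v x = grad_dot v w x)//.
  by apply: eq_bigr => j _; rewrite mulrC.
have faceC (F : face R d (nelem M)) : face_form F w v = face_form F v w.
  by apply: eq_integral_rV => y _; rewrite addrC mulrC [X in _ + X]mulrC.
have ifaceC : \sum_(e < niface M) face_form (iface M e) w v =
    \sum_(e < niface M) face_form (iface M e) v w.
  by apply: eq_bigr => e _; exact: faceC.
have bC : dg_formb bc w v = dg_formb bc v w.
  case: bc => [P|]; last by [].
  have bfaceC : \sum_(e < nbface P) face_form (bface P e) w v =
      \sum_(e < nbface P) face_form (bface P e) v w.
    by apply: eq_bigr => e _; exact: faceC.
  exact: (congr1 ( *%R 2^-1) bfaceC).
exact: (congr2 +%R (congr2 +%R volC ifaceC) bC).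
Qed.

(** By symmetry only the first argument has to be treated, term by term. Elements and faces lie in
    the compact closure of [Omega], hence are bounded, which makes every integrand integrable. *)
Lemma dg_form_bilin (Omega : set E) (M : mesh R d) (k : nat) (a : R)
    (bc : boundary_condition R d (nelem M)) :
  bounded_set Omega -> is_mesh Omega M -> is_boundary_condition Omega bc ->
  bilinear_on (dg_space M k) (dg_form bc a).
Proof.
move=> bO [elemP _ _ [ifaceP _] _] bcP.
have bsub (D : set E) : D `<=` closure Omega -> bounded_set D.
  move=> DO; have [C [Cr hC]] := compact_bounded (compact_closure_bounded bO).
  by exists C; split=> // N CN y /DO; exact: hC.
have oK i : open (elem M i) by case: (elemP i).
have bK i : bounded_set (elem M i).
  have [_ _ _ KO] := elemP i.
  by apply: bsub => x /KO; exact: subset_closure.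
pose W := [set w : fct | forall i, C1_ext (elem M i) w].
have VW : dg_space M k `<=` W by move=> w Vw i; exact: dg_space_C1 Vw.
apply: sym_bilinear_on => [|v /VW Wv]; first exact: dg_formC.
apply: (sub_linear_on VW).
  apply: linear_on_add; first apply: linear_on_add.
  - apply: linear_on_sum_form => i.
    apply: (@sub_linear_on _ _ _ (C1_ext (elem M i))); first by move=> w; exact.
    exact: volume_form_lin.
  - apply: linear_on_sum_form => e; have [Ff _ _ FO] := ifaceP e.
    apply: face_form_lin => //; apply: bsub => x /FO; exact: subset_closure.
  case: bc bcP => [P [_ bfP _ _ _]|_].
    apply: linear_on_mul; apply: linear_on_sum_form => e.
    have [Ff _ FO] := bfP e.
    by apply: face_form_lin => //; apply: bsub => x /FO[].
  by move=> c f g _ _; rewrite /= mulr0 addr0.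
Qed.

End FormLinear.

(** * Application of the abstract step to the DG space and form *)

Theorem theorem4p1 (R : realType) (d k : nat) (Omega : set 'rV[R]_d.+1)
    (M : mesh R d) (sigma a : R) (bc : boundary_condition R d (nelem M))
    (Phi : R -> R) (B dt : R) (un qn : 'rV[R]_d.+1 -> R) (rn : R) :
  let V := dg_space M k in
  let dot := L2dot Omega in
  let A := dg_form bc a in
  let Pi := L2proj Omega V in
  let Bh := inv_I_sqr Omega V A in
  convex_bounded_domain Omega ->
  is_mesh Omega M ->
  shape_regular sigma M ->
  is_boundary_condition Omega bc ->
  (forall s, derivable Phi s 1) ->
  continuous (derive1 Phi) ->
  (forall v, V v -> 0 < integral_rV Omega (fun x => Phi (v x)) + B) ->
  0 < dt ->
  V un ->
  V qn ->
  (forall psi, V psi -> dot qn psi = A un psi) ->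
  let b := sav_b Omega Phi B un in
  let Dt (u : 'rV[R]_d.+1 -> R) := fun x => (u x - un x) / dt in
  let lin_step u q r :=
    [/\ V u, V q,
        forall phi, V phi -> dot (Dt u) phi = - A q phi - dot b phi * r
      & forall psi, V psi -> dot q psi = A u psi] in
  let sav_step u q r :=
    [/\ V u, V q,
        forall phi, V phi -> dot (Dt u) phi = - A q phi - r * dot b phi,
        forall psi, V psi -> dot q psi = A u psi
      & (r - rn) / dt = 2^-1 * integral_rV Omega (fun x => b x * Dt u x)] in
  let xi := fun x => un x - dt * rn * Pi b x + dt / 2 * dot b un * Pi b x in
  let den := 1 + dt / 2 * dot (Pi b) (Bh dt (Pi b)) in
  let Rn := dot b (Bh dt xi) / den in
  let r1 := rn - 2^-1 * dot (Pi b) un + 2^-1 * Rn in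
  [/\ den != 0,
      exists! s, sav_step s.1.1 s.1.2 s.2
    & forall u q r, sav_step u q r <-> r = r1 /\ lin_step u q r1].
Proof.
move=> V dot A Pi Bh [oO _ _ bO] meshM _ bcP _ cPhi _ dt_gt0 Vun _ _ b.
have [elemP disj _ _ _] := meshM.
have elemO i : open (elem M i) /\ elem M i `<=` Omega by case: (elemP i).
have VW : V `<=` bounded_meas Omega by exact: dg_space_bounded_meas.
(* The space of bounded measurable functions contains both [V] and [b], although [b] need not be
   piecewise polynomial. *)
apply: (@sav_step_realization _ _ _ _ (bounded_meas Omega)).
- exact: dg_space0.
- exact: dg_space_lin.
- exact: dg_space_finite_dim.
- exact: VW.
- by apply: L2dot_bounded_meas_bilin; exact: open_bounded_meas_set.
- by move=> v; exact: L2dot_dg_def.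
- exact: dg_form_bilin bO meshM bcP.
- exact: dg_formC.
- exact: dt_gt0.
- exact: Vun.
- exact: sav_b_bounded_meas cPhi Vun.
Qed.
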